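(* Let $\mathbb A$ be a Weil algebra. For every $B=[\phi]_\times\in\mathfrak{so}(3,\mathbb A)$, $\phi\in\mathbb A^3$, with $S=\phi^T\phi\in\mathbb A$, the matrix exponential $\operatorname{Exp}_{\mathbb A}$ obtained by finite Weil prolongation of the real matrix exponential satisfies the exact algebraic identity in $M_3(\mathbb A)$ $$\operatorname{Exp}_{\mathbb A}(B)=I+a_{\mathbb A}(S)\,B+b_{\mathbb A}(S)\,B^2,$$ and $\operatorname{Exp}_{\mathbb A}(B)\in\mathrm{SO}(3,\mathbb A)$.
   Context: A Weil algebra is a finite-dimensional, commutative, associative real algebra with unit of the form $\mathbb A=\mathbb R 1_{\mathbb A}\oplus\mathfrak m$, where $\mathfrak m$ is the unique maximal ideal and $\mathfrak m^{N+1}=0$, $\mathfrak m^N\neq 0$; $N$ is its nilpotency index. The scalar-part projection $\pi:\mathbb A\to\mathbb R$ is the algebra morphism with kernel $\mathfrak m$; it acts componentwise on $\mathbb A^p$. Finite Weil prolongation: for $U\subset\mathbb R^p$ open put $U^{\mathbb A}=\{X\in\mathbb A^p:\pi(X)\in U\}$. For $f\in C^N(U,\mathbb R^q)$, $x\in U$, $H\in\mathfrak m^p=\mathfrak m\times\cdots\times\mathfrak m$, $$(J_{\mathbb A}f)(x+H)=\sum_{|\alpha|\le N}\frac1{\alpha!}(\partial^\alpha f)(x)H^\alpha\in\mathbb A^q .$$ $M_3(\mathbb A)$ is the algebra of $3\times3$ matrices over $\mathbb A$; $\mathfrak{so}(3,\mathbb A)=\{B\in M_3(\mathbb A):B^T=-B\}$;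 $\mathrm{SO}(3,\mathbb A)=\{Q\in M_3(\mathbb A):Q^TQ=I,\ \det Q=1\}$. $\operatorname{Exp}_{\mathbb A}:M_3(\mathbb A)\to M_3(\mathbb A)$ is the finite Weil prolongation $J_{\mathbb A}\exp$ of the real matrix exponential $\exp:M_3(\mathbb R)\to M_3(\mathbb R)$ (with $M_3(\mathbb R)\cong\mathbb R^9$). For $\phi=(\phi_1,\phi_2,\phi_3)^T\in\mathbb A^3$, $$[\phi]_\times=\begin{pmatrix}0&-\phi_3&\phi_2\\ \phi_3&0&-\phi_1\\ -\phi_2&\phi_1&0\end{pmatrix}.$$ The smooth functions $a,b:\mathbb R\to\mathbb R$ are: $a(s)=\sin\sqrt s/\sqrt s$ for $s>0$, $a(0)=1$, $a(s)=\sinh\sqrt{-s}/\sqrt{-s}$ for $s<0$; $b(s)=(1-\cos\sqrt s)/s$ for $s>0$, $b(0)=1/2$, $b(s)=(\cosh\sqrt{-s}-1)/(-s)$ for $s<0$. One writes $a_{\mathbb A}=J_{\mathbb A}a$, $b_{\mathbb A}=J_{\mathbb A}b:\mathbb A\to\mathbb A$. *)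

(* Defs.v *)
From HB Require Import structures.
From mathcomp Require Import all_boot all_order all_algebra falgebra.
From mathcomp Require Import ring_quotient.
From mathcomp Require Import all_classical all_reals all_analysis.

Set Implicit Arguments.
Unset Strict Implicit.
Unset Printing Implicit Defensive.

Import Order.TTheory GRing.Theory Num.Theory.
Import numFieldNormedType.Exports.

Local Open Scope ring_scope.

(* [idealr_closed] includes properness (1 \notin I). *)
Definition maximal_ideal (A : comNzRingType) (I : {pred A}) : Prop :=
  idealr_closed I /\
  forall J : {pred A}, idealr_closed J -> {subset I <= J} -> {subset J <= I}.

HB.structure Definition ComFalgebra (R : fieldType) :=
  { A of Falgebra R A & GRing.ComUnitAlgebra R A }.

(* A finite-dimensional commutative unital R-algebra A = R1 (+) m, with m the
   unique maximal ideal, m ^ N.+1 = 0 and m ^ N != 0.  The powers are those of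
   subspaces of an algebra (the span of the n-fold products); for n > 0 they
   are the powers of the ideal m.  The unit-ring structure carried by [falgType]
   exists on every finite-dimensional algebra and is not a restriction. *)
HB.mixin Record isWeilAlgebra (R : realType) A of ComFalgebra R A := {
  weil_ideal : {vspace A};
  weil_index : nat;
  weil_decomp : (1 + weil_ideal)%VS = fullv /\ directv (1 + weil_ideal);
  weil_ideal_max : maximal_ideal [in weil_ideal];
  weil_ideal_unique : forall I : {pred A}, maximal_ideal I -> I =i weil_ideal;
  weil_nilp : (weil_ideal ^+ weil_index.+1)%VS = 0%VS;
  weil_nilp_min : (weil_ideal ^+ weil_index)%VS != 0%VS
}.

#[short(type="weilAlgType")]
HB.structure Definition WeilAlgebra (R : realType) :=
  { A of isWeilAlgebra R A & ComFalgebra R A }.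

Section ScalarPart.
Context {R : realType} {A : weilAlgType R}.
Implicit Types (x y : A) (r : R).

Local Notation m := (weil_ideal : {vspace A}).

(* The unique r such that x - r%:A lies in m (see scalar_part_uniq). *)
Definition scalar_part x : R := get [set r : R | x - r%:A \in m].

Let one_notin : 1 \notin m.
Proof. by have [[_ + _] _] := @weil_ideal_max R A. Qed.

Lemma scalar_part_uniq x r : x - r%:A \in m -> scalar_part x = r.
Proof.
move=> xr; have xg : x - (scalar_part x)%:A \in m.
  by have := @getI _ [set r : R | x - r%:A \in m] r xr.
apply/eqP; rewrite -subr_eq0; apply/negPn/negP => d0.
have := memvB xr xg; rewrite opprB addrC addrA subrK -scalerBl.
move=> /(memvZ (scalar_part x - r)^-1).
by rewrite scalerA mulVf// scale1r (negPf one_notin).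
Qed.

Lemma scalar_partP x : x - (scalar_part x)%:A \in m.
Proof.
have : x \in (1 + m)%VS by rewrite (weil_decomp : _ /\ _).1 memvf.
move=> /memv_addP[u /vlineP[r ->] [v vm xE]].
have xr : x - r%:A \in m by rewrite xE addrC addKr.
by rewrite (scalar_part_uniq xr).
Qed.

Let idealM x y : y \in m -> x * y \in m.
Proof.
move=> ym; have [[m0 _ mM] _] := @weil_ideal_max R A.
by have := mM x y 0 ym m0; rewrite addr0.
Qed.

Lemma scalar_partZ r x : scalar_part (r *: x) = r * scalar_part x.
Proof.
by apply: scalar_part_uniq; rewrite -scalerA -scalerBr memvZ ?scalar_partP.
Qed.

Fact scalar_part_is_zmod_morphism : zmod_morphism scalar_part.
Proof.
move=> x y; apply: scalar_part_uniq.
have -> : x - y - (scalar_part x - scalar_part y)%:A =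
    (x - (scalar_part x)%:A) - (y - (scalar_part y)%:A).
  by rewrite scalerBl !opprD !opprK addrACA.
by rewrite memvB ?scalar_partP.
Qed.

Fact scalar_part_is_monoid_morphism : monoid_morphism scalar_part.
Proof.
split; first by apply: scalar_part_uniq; rewrite scale1r subrr mem0v.
move=> x y; apply: scalar_part_uniq.
rewrite -scalerA -mulr_algl.
have -> : x * y - (scalar_part x)%:A * (scalar_part y)%:A =
    x * (y - (scalar_part y)%:A) + (scalar_part y)%:A * (x - (scalar_part x)%:A).
  by rewrite !mulrBr [_%:A * x]mulrC addrA subrK [_%:A * _]mulrC.
by rewrite memvD ?idealM ?scalar_partP.
Qed.

HB.instance Definition _ :=
  GRing.isZmodMorphism.Build A R scalar_part scalar_part_is_zmod_morphism.
HB.instance Definition _ :=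
  GRing.isMonoidMorphism.Build A R scalar_part scalar_part_is_monoid_morphism.

Lemma scalar_part_ker x : (scalar_part x == 0) = (x \in m).
Proof.
apply/eqP/idP => [x0|xm].
  by have := scalar_partP x; rewrite x0 scale0r subr0.
by apply: scalar_part_uniq; rewrite scale0r subr0.
Qed.

End ScalarPart.

Section PartialDerivatives.
Context {R : realType} {p q : nat}.

Definition partial (i : 'I_p) (f : 'rV[R]_p -> 'rV[R]_q) : 'rV[R]_p -> 'rV[R]_q :=
  fun x => 'D_(delta_mx 0 i) f x.

(* The derivatives are applied in the order p-1, ..., 0; on the C^N functions
   that are prolonged the order is immaterial. *)
Definition mpartial (alpha : 'I_p -> nat) (f : 'rV[R]_p -> 'rV[R]_q) :
    'rV[R]_p -> 'rV[R]_q :=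
  foldr (fun i => iter (alpha i) (partial i)) f (enum 'I_p).

End PartialDerivatives.

Section Prolongation.
Context {R : realType} (A : weilAlgType R).

Local Notation N := (@weil_index R A).

Definition nilpotent_part {k l} (X : 'M[A]_(k, l)) : 'M[A]_(k, l) :=
  X - map_mx (in_alg A \o scalar_part) X.

(* J_A f at X = x + H, with x the scalar part of X. Only the values of f near x
   are used, so a total f covers every open domain. A multi-index alpha with
   |alpha| <= N has all its entries <= N, whence its type. *)
Definition weil_prolong {p q} (f : 'rV[R]_p -> 'rV[R]_q) (X : 'rV[A]_p) :
    'rV[A]_q :=
  let x := map_mx scalar_part X in
  let H := nilpotent_part X in
  \row_(j < q)
    \sum_(alpha : {ffun 'I_p -> 'I_N.+1} | (\sum_i alpha i <= N)%N)
      ((\prod_i (alpha i)`!)%N%:R^-1 * mpartial (fun i => alpha i) f x 0 j)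
        *: \prod_i H 0 i ^+ alpha i.

Definition weil_prolong1 (f : R -> R) (X : A) : A :=
  weil_prolong (fun v : 'rV[R]_1 => const_mx (f (v 0 0)) : 'rV[R]_1)
    (const_mx X) 0 0.

(* M_k ~ R^(k * k), through the library's [mxvec]. *)
Definition weil_prolong_mx {k} (f : 'M[R]_k -> 'M[R]_k) (X : 'M[A]_k) : 'M[A]_k :=
  vec_mx (weil_prolong (fun v => mxvec (f (vec_mx v))) (mxvec X)).

End Prolongation.

Definition expmx {R : realType} {n} (X : 'M[R]_n.+1) : 'M[R]_n.+1 :=
  limn (series (fun k => k`!%:R^-1 *: X ^+ k)).

Definition sinh {R : realType} (x : R) : R := (expR x - expR (- x)) / 2.
Definition cosh {R : realType} (x : R) : R := (expR x + expR (- x)) / 2.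

Definition afun {R : realType} (s : R) : R :=
  if 0 < s then sin (Num.sqrt s) / Num.sqrt s
  else if s < 0 then sinh (Num.sqrt (- s)) / Num.sqrt (- s)
  else 1.

Definition bfun {R : realType} (s : R) : R :=
  if 0 < s then (1 - cos (Num.sqrt s)) / s
  else if s < 0 then (cosh (Num.sqrt (- s)) - 1) / (- s)
  else 1 / 2.

Section Rotations.
Variable A : comNzRingType.

Definition so3 (B : 'M[A]_3) : Prop := B^T = - B.
Definition SO3 (Q : 'M[A]_3) : Prop := Q^T *m Q = 1%:M /\ \det Q = 1.

Definition hat (phi : 'cV[A]_3) : 'M[A]_3 :=
  let phi1 := phi 0 0 in let phi2 := phi 1 0 in let phi3 := phi 2 0 in
  \matrix_(i, j) nth 0 (nth [::]
    [:: [:: 0;      - phi3; phi2  ];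
        [:: phi3;   0;      - phi1];
        [:: - phi2; phi1;   0     ]] i) j.

End Rotations.

Definition Exp_weil {R : realType} (A : weilAlgType R) : 'M[A]_3 -> 'M[A]_3 :=
  weil_prolong_mx expmx.

(* Main.v *)
(* The skew matrix B = [phi] satisfies B^3 = - S B, so a partial sum P(B) of its
   exponential series is P(C)_00 I + P(C)_01 B + P(C)_02 B^2, where C = C(S) is the
   companion matrix of the equation y^(3) = - S y^(1); for real s the entries 01 and 02
   of exp C(s) are a(s) and b(s).  Hence the identity reduces to a statement about
   x |-> exp (L x) with L affine: the Weil prolongation of an entry is the limit in A
   (coordinatewise) of the partial sums evaluated in A.  For polynomials
   prolongation is evaluation, by the binomial formula and the nilpotency of m.  The
   derivatives converge because, for F either exp or a partial sum, the derivative
   of F at X along V is the upper right block of F [[X, V], [0, X]]: every iterated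
   derivative of F o L is again an entry of F o L', with the same L' for all F.
   Orthogonality is P(-B) P(B) -> I in A, and det = 1 follows from it and the
   Rodrigues form. *)
Require Import Defs.
From HB Require Import structures.
From mathcomp Require Import all_boot all_order all_algebra falgebra.
From mathcomp Require Import ring.
From mathcomp Require Import all_classical all_reals all_analysis.

Set Implicit Arguments.
Unset Strict Implicit.
Unset Printing Implicit Defensive.

Import Order.TTheory GRing.Theory Num.Theory.
Import numFieldNormedType.Exports.

Local Open Scope ring_scope.

(** * Derivatives of matrix functions *)

Lemma cvg_mx_entries {U : Type} {F : set_system U} {FF : Filter F}
    {T : topologicalType} {m n} (f : U -> 'M[T]_(m, n)) (M : 'M[T]_(m, n)) :
  (forall i j, f u i j @[u --> F] --> M i j)%classic ->
  (f u @[u --> F] --> M)%classic.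
Proof.
move=> fM P [Q nQ QP].
have fQ : (\forall u \near F, forall i j, Q i j (f u i j))%classic.
  by apply: filter_forall => i; apply: filter_forall => j; apply: fM.
by apply: filterS fQ => u; exact: QP.
Qed.

Section RealMatrixFunctions.
Context {R : realType}.

Definition mxfun := forall n, 'M[R]_n -> 'M[R]_n.

(** The two properties shared by exp and its partial sums from which all derivatives are computed.
    Rectangular intertwiners relate [F] on block triangular matrices of size 2n to [F] on size n;
    bounds on bounded sets give continuity along lines. *)
Record regular_mxfun (F : mxfun) : Prop := RegularMxfun {
  regular_intertwine : forall n m (X : 'M[R]_n) (Y : 'M[R]_m) (T : 'M[R]_(n, m)),
    X *m T = T *m Y -> F n X *m T = T *m F m Y;
  regular_bounded : forall n (r : R), exists M, forall X : 'M[R]_n,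
    (forall i j, `|X i j| <= r) -> forall i j, `|F n X i j| <= M }.

Section Derivative.
Variables (F : mxfun) (Freg : regular_mxfun F).

(** For M = [[X, V], [0, Y]] with Y = X + h V, the block columns (1, 0) and (1, h) intertwine M with
    X and with Y. Comparing first block rows of [F M] gives the increment exactly, for every h and
    without a limit. *)
Lemma mxfun_increment n (X V : 'M[R]_n) h :
  F (X + h *: V) = F X + h *: ursubmx (F (block_mx X V 0 (X + h *: V))).
Proof.
set Y := X + h *: V; set M := block_mx X V 0 Y.
have MT1 : M *m col_mx 1%:M 0 = col_mx 1%:M 0 *m X.
  by rewrite mul_block_col mul_col_mx !mulmx1 !mulmx0 mul1mx !mul0mx !addr0.
have MT2 : M *m col_mx 1%:M h%:M = col_mx 1%:M h%:M *m Y.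
  rewrite mul_block_col mul_col_mx mul1mx !mulmx1 add0r.
  by rewrite !mul_mx_scalar mul_scalar_mx.
have := regular_intertwine Freg MT2; have := regular_intertwine Freg MT1.
rewrite -[F M]submxK !mul_block_col !mul_col_mx !mul1mx !mulmx1 !mulmx0 !addr0.
move=> /eq_col_mx[-> _] /eq_col_mx[<- _].
by rewrite mul_mx_scalar block_mxKur.
Qed.

Lemma mxfun_continuous_line n (X V : 'M[R]_n) :
  exists M, forall h i j, `|h| <= 1 ->
    `|F (X + h *: V) i j - F X i j| <= `|h| * M.
Proof.
(* [r] dominates every entry of [[X, V], [0, X + h V]] as long as |h| <= 1. *)
pose r := \sum_i \sum_j (`|X i j| + `|V i j|).
have r_ge i j : `|X i j| + `|V i j| <= r.
  rewrite /r (bigD1 i)//= (bigD1 j)//= -addrA lerDl addr_ge0//.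
    by apply: sumr_ge0 => ? _; rewrite addr_ge0.
  by apply: sumr_ge0 => ? _; apply: sumr_ge0 => ? _; rewrite addr_ge0.
have [M FM] := regular_bounded Freg (n + n) r.
exists M => h i j h1.
rewrite mxfun_increment [in X in `|X|]mxE addrAC subrr add0r.
rewrite mxE normrM ler_wpM2l// mxE mxE; apply: FM => {}i {}j.
have r0 k l : 0 <= `|X k l| + `|V k l| by rewrite addr_ge0.
rewrite -[i]fintype.splitK -[j]fintype.splitK.
case: (fintype.split i) => {}i; case: (fintype.split j) => {}j /=.
- by rewrite block_mxEul (le_trans _ (r_ge i j))// lerDl.
- by rewrite block_mxEur (le_trans _ (r_ge i j))// lerDr.
- by rewrite block_mxEdl mxE normr0 (le_trans (r0 i j))// r_ge.
- rewrite block_mxEdr !mxE (le_trans _ (r_ge i j))//.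
  by rewrite (le_trans (ler_normD _ _))// lerD2l normrM ler_piMl.
Qed.

Lemma mxfun_derivative n (X V : 'M[R]_n) i j :
  (h^-1 * (F (X + h *: V) i j - F X i j) @[h --> (0 : R)^'] -->
    ursubmx (F (block_mx X V 0 X)) i j)%classic.
Proof.
(* The difference quotient is a block of [F] at a matrix of size 2n that depends on h only through
   its lower right block, hence moves along a line; continuity along that line gives the limit. *)
have [M FM] := mxfun_continuous_line (block_mx X V 0 X) (block_mx 0 0 0 V).
have blockE h : block_mx X V 0 X + h *: block_mx 0 0 0 V =
    block_mx X V 0 (X + h *: V).
  by rewrite scale_block_mx add_block_mx !scaler0 !addr0.
apply/cvgrPdist_le => e e0.
have M1 : 0 < `|M| + 1 by rewrite ltr_wpDl.
near=> h.
have h0 : h != 0 by near: h; exact: nbhs_dnbhs_neq.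
have h1 : `|h| <= 1.
  near: h; apply: dnbhs0_le; exact: ltr01.
rewrite mxfun_increment [X in h^-1 * (X - _)]mxE addrAC subrr add0r.
rewrite [X in _ - _ * X]mxE mulKf// -blockE !mxE distrC (le_trans (FM _ _ _ h1))//.
rewrite (le_trans (ler_wpM2l _ (ler_norm M)))//.
have : `|h| <= e / (`|M| + 1).
  by near: h; apply: dnbhs0_le; rewrite divr_gt0.
rewrite ler_pdivlMr// => /(le_trans _); apply.
by rewrite ler_wpM2l// lerDl.
Unshelve. all: by end_near. Qed.

End Derivative.
End RealMatrixFunctions.

(** * The real matrix exponential *)

(** The factorials are inverted in R and then sent to T by [iota], so that one expression serves
    both R and the Weil algebra. *)
Definition mxexp_sum {R : realType} {T : comNzRingType} (iota : R -> T) (K : nat)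
    {n} (X : 'M[T]_n) : 'M[T]_n :=
  \sum_(k < K) iota k`!%:R^-1 *: X ^+ k.

(** Defined at every size, as [mxfun] demands, while [expmx] needs a nonzero size; [expmxE]
    identifies the two. *)
Definition mxexp {R : realType} {n} (X : 'M[R]_n) : 'M[R]_n :=
  \matrix_(i, j) limn (fun K => mxexp_sum idfun K X i j).

Section RealExponential.
Context {R : realType}.

Lemma mxpowS {T : comNzRingType} n (X : 'M[T]_n) k : X ^+ k.+1 = X *m X ^+ k.
Proof. exact: exprS. Qed.

Lemma mxpowSr {T : comNzRingType} n (X : 'M[T]_n) k : X ^+ k.+1 = X ^+ k *m X.
Proof. exact: exprSr. Qed.

Lemma mxpow_intertwine {T : comNzRingType} n m (X : 'M[T]_n) (Y : 'M[T]_m)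
    (P : 'M[T]_(n, m)) k :
  X *m P = P *m Y -> X ^+ k *m P = P *m Y ^+ k.
Proof.
move=> XP; elim: k => [|k IH]; first by rewrite !expr0 mul1mx mulmx1.
by rewrite !mxpowS -mulmxA IH !mulmxA XP.
Qed.

Lemma mxexp_sum_intertwine {T : comNzRingType} (iota : R -> T) K n m
    (X : 'M[T]_n) (Y : 'M[T]_m) (P : 'M[T]_(n, m)) :
  X *m P = P *m Y -> mxexp_sum iota K X *m P = P *m mxexp_sum iota K Y.
Proof.
move=> XP; rewrite mulmx_suml mulmx_sumr; apply: eq_bigr => k _.
by rewrite -scalemxAl (mxpow_intertwine k XP) scalemxAr.
Qed.

Lemma mxpow_bounded n (X : 'M[R]_n) r k i j :
  (forall i j, `|X i j| <= r) -> `|(X ^+ k) i j| <= (n%:R * r) ^+ k.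
Proof.
move=> Xr; elim: k i j => [|k IH] i j.
  by rewrite !expr0 mxE; case: (i == j); rewrite ?normr1 ?normr0.
rewrite mxpowS mxE (le_trans (ler_norm_sum _ _ _))//.
rewrite (le_trans (y := \sum_(l < n) r * (n%:R * r) ^+ k))//.
  by apply: ler_sum => l _; rewrite normrM ler_pM.
by rewrite sumr_const card_ord exprS -mulrA [leRHS]mulr_natl.
Qed.

Lemma mxexp_sumE K n (X : 'M[R]_n) i j :
  mxexp_sum idfun K X i j = series (fun k => k`!%:R^-1 * (X ^+ k) i j) K.
Proof.
by rewrite /mxexp_sum summxE seriesEord; apply: eq_bigr => k _; rewrite mxE.
Qed.

Lemma mxexp_term_bounded n (X : 'M[R]_n) r k i j :
  (forall i j, `|X i j| <= r) ->
  `|k`!%:R^-1 * (X ^+ k) i j| <= exp_coeff (n%:R * r) k.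
Proof.
move=> Xr; rewrite normrM ger0_norm// mulrC /exp_coeff /=.
by rewrite ler_wpM2r// mxpow_bounded.
Qed.

(** The bound is independent of K, so the limit [mxexp] inherits it. *)
Lemma mxexp_sum_bounded K n (X : 'M[R]_n) r i j :
  (forall i j, `|X i j| <= r) ->
  `|mxexp_sum idfun K X i j| <= expR (n%:R * r).
Proof.
move=> Xr; rewrite mxexp_sumE.
have r0 : 0 <= n%:R * r :> R.
  by rewrite mulr_ge0// (le_trans (normr_ge0 (X i j))).
rewrite (le_trans (y := series (exp_coeff (n%:R * r)) K))//.
  rewrite !seriesEord (le_trans (ler_norm_sum _ _ _))//.
  by apply: ler_sum => k _; exact: mxexp_term_bounded.
apply: nondecreasing_cvgn_le; last exact: is_cvg_series_exp_coeff.
apply/nondecreasing_seqP => k; rewrite seriesSr lerDl.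
exact: exp_coeff_ge0.
Qed.

Lemma is_cvg_mxexp_sum n (X : 'M[R]_n) i j :
  cvgn (fun K => mxexp_sum idfun K X i j).
Proof.
pose r := \sum_i \sum_j `|X i j|.
have Xr k l : `|X k l| <= r.
  rewrite /r (bigD1 k)//= (bigD1 l)//= -addrA lerDl addr_ge0//.
    by apply: sumr_ge0 => ? _.
  by apply: sumr_ge0 => ? _; apply: sumr_ge0 => ? _.
under eq_fun do rewrite mxexp_sumE.
apply: normed_cvg; apply: series_le_cvg (is_cvg_series_exp_coeff (n%:R * r)).
- by move=> k /=.
- move=> k; apply: exp_coeff_ge0.
  by rewrite mulr_ge0// (le_trans (normr_ge0 (X i j))).
- by move=> k /=; exact: mxexp_term_bounded.
Qed.

Lemma cvg_mxexp_sum n (X : 'M[R]_n) i j :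
  (mxexp_sum idfun K X i j @[K --> \oo] --> mxexp X i j)%classic.
Proof. by rewrite mxE; exact: is_cvg_mxexp_sum. Qed.

Lemma cvg_mulmx_entry {U : Type} {F : set_system U} {FF : Filter F} {m n p}
    (u : 'M[R]_(m, n)) (v : 'M[R]_(n, p)) (X : U -> 'M[R]_n) (Y : 'M[R]_n) i j :
  (forall k l, (X t k l @[t --> F] --> Y k l)%classic) ->
  ((u *m X t *m v) i j @[t --> F] --> (u *m Y *m v) i j)%classic.
Proof.
move=> XY; rewrite mxE; under eq_fun do rewrite mxE.
apply: cvg_big => [x| l _]; first exact: add_continuous.
rewrite mxE; under eq_fun do rewrite mxE.
apply: cvgM; last exact: cvg_cst.
apply: cvg_big => [x| k _]; first exact: add_continuous.
by apply: cvgM; [exact: cvg_cst | exact: XY].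
Qed.

Lemma regular_mxexp_sum K : regular_mxfun (fun n => @mxexp_sum R R idfun K n).
Proof.
split=> [n m X Y T XT|n r]; first exact: mxexp_sum_intertwine.
by exists (expR (n%:R * r)) => X Xr i j; exact: mxexp_sum_bounded.
Qed.

Lemma regular_mxexp : regular_mxfun (@mxexp R).
Proof.
split=> [n m X Y T XT|n r].
  apply/matrixP => i j.
  have lX := @cvg_mulmx_entry _ _ eventually_filter _ _ _ 1%:M T _ _ i j
    (@cvg_mxexp_sum n X).
  have lY := @cvg_mulmx_entry _ _ eventually_filter _ _ _ T 1%:M _ _ i j
    (@cvg_mxexp_sum m Y).
  rewrite mul1mx in lX; rewrite mulmx1 in lY.
  have XY : (fun K => (1%:M *m mxexp_sum idfun K X *m T) i j) =
      (fun K => (T *m mxexp_sum idfun K Y *m 1%:M) i j).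
    by apply/funext => K; rewrite mul1mx mulmx1 (mxexp_sum_intertwine _ _ XT).
  by rewrite XY in lX; apply: cvg_unique lX lY; exact: Rhausdorff.
exists (expR (n%:R * r)) => X Xr i j; rewrite mxE ler_norml; apply/andP; split.
  apply: limr_ge; first exact: is_cvg_mxexp_sum.
  by near=> K; have := mxexp_sum_bounded K i j Xr; rewrite ler_norml => /andP[].
apply: limr_le; first exact: is_cvg_mxexp_sum.
by near=> K; have := mxexp_sum_bounded K i j Xr; rewrite ler_norml => /andP[].
Unshelve. all: by end_near. Qed.

Lemma expmxE n (X : 'M[R]_n.+1) : expmx X = mxexp X.
Proof.
rewrite /expmx seriesEord; apply: cvg_lim; first exact: norm_hausdorff.
apply: cvg_mx_entries => i j.
exact: cvg_mxexp_sum.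
Qed.

End RealExponential.

(** * Iterated partial derivatives *)

(** Data of a function x |-> u F(L x) v, with L affine and u, v a row and a column. The size is a
    field because each differentiation doubles it; the coefficients stay real and are transported to
    T only on evaluation. *)
Record affdata {R : Type} (p : nat) := AffData {
  adim : nat;
  aconst : 'M[R]_adim;
  acoef : 'I_p -> 'M[R]_adim;
  aleft : 'rV[R]_adim;
  aright : 'cV[R]_adim }.

Definition affval {R : Type} {T : comNzRingType} (iota : R -> T) {p}
    (D : affdata p) (x : 'rV[T]_p) : 'M[T]_(adim D) :=
  map_mx iota (aconst D) + \sum_i x 0 i *: map_mx iota (acoef D i).

Definition mxcoef {R : Type} {T : comNzRingType} (iota : R -> T)
    (F : forall n, 'M[T]_n -> 'M[T]_n) {p} (D : affdata p) (x : 'rV[T]_p) : T :=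
  (map_mx iota (aleft D) *m F _ (affval iota D x) *m map_mx iota (aright D)) 0 0.

Section IteratedDerivatives.
Context {R : realType} {p q : nat}.

(** The affine map becomes [[L, L_i], [0, L]], with L_i the coefficient of x_i; the row (u, 0) and
    the column (0, v) select the upper right block, which holds the derivative. *)
Definition affderiv (i : 'I_p) (D : @affdata R p) : affdata p :=
  AffData (block_mx (aconst D) (acoef D i) 0 (aconst D))
    (fun k => block_mx (acoef D k) 0 0 (acoef D k))
    (row_mx (aleft D) 0) (col_mx 0 (aright D)).

Definition mxcoefs (F : @mxfun R) (D : 'I_q -> affdata p) (x : 'rV[R]_p) :
    'rV[R]_q :=
  \row_j mxcoef (T := R) idfun F (D j) x.

Lemma map_mx_idfun m n (X : 'M[R]_(m, n)) : map_mx idfun X = X.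
Proof. exact: map_mx_id. Qed.

Lemma affval_line (D : affdata p) x h i :
  affval (T := R) idfun D (h *: delta_mx 0 i + x) =
  affval (T := R) idfun D x + h *: acoef D i.
Proof.
rewrite /affval -addrA; congr (_ + _).
under eq_bigr do rewrite mxE scalerDl.
rewrite big_split/= addrC; congr (_ + _).
rewrite (bigD1 i)//= big1 => [|k ki]; rewrite !mxE /= ?eqxx.
  by rewrite mulr1 addr0 map_mx_idfun.
by rewrite (negPf ki) mulr0 scale0r.
Qed.

Lemma affval_deriv (D : affdata p) x i :
  affval (T := R) idfun (affderiv i D) x =
  block_mx (affval (T := R) idfun D x) (acoef D i) 0 (affval (T := R) idfun D x).
Proof.
rewrite /affval /=.
have -> : \sum_k x 0 k *: map_mx idfun (block_mx (acoef D k) 0 0 (acoef D k)) =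
   block_mx (\sum_k x 0 k *: map_mx idfun (acoef D k)) 0 0
            (\sum_k x 0 k *: map_mx idfun (acoef D k)).
  elim/big_rec2: _ => [|k y1 y2 _ ->]; first by rewrite -block_mx0.
  by rewrite !map_mx_idfun scale_block_mx !scaler0 add_block_mx !addr0.
by rewrite !map_mx_idfun add_block_mx !addr0.
Qed.

Lemma partial_mxcoefs (F : mxfun) : regular_mxfun F ->
  forall (i : 'I_p) D,
  partial i (mxcoefs F D) = mxcoefs F (fun j => affderiv i (D j)).
Proof.
move=> Freg i D; apply/funext => x.
apply: cvg_lim; first exact: norm_hausdorff.
apply: cvg_mx_entries => k j; rewrite {k}ord1 mxE.
rewrite /mxcoef affval_deriv !map_mx_idfun /=.
set M := F _ (block_mx _ _ _ _).
have -> : row_mx (aleft (D j)) 0 *m M *m col_mx 0 (aright (D j)) =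
    aleft (D j) *m ursubmx M *m aright (D j).
  rewrite -[M]submxK mul_row_block !mul0mx !addr0 mul_row_col mulmx0 add0r.
  by rewrite block_mxKur.
set X := affval (T := R) idfun (D j) x; set V := acoef (D j) i.
(* By linearity of M |-> u M v, the limit can be taken on the entries of the matrix quotient. *)
pose Q h : 'M[R]_(adim (D j)) := h^-1 *: (F _ (X + h *: V) - F _ X).
have -> : (fun h : R => (h^-1 *: ((mxcoefs F D \o shift x) (h *: delta_mx 0 i) -
    mxcoefs F D x)) 0 j) = (fun h => (aleft (D j) *m Q h *m aright (D j)) 0 0).
  apply/funext => h; rewrite /Q -scalemxAr -scalemxAl mulmxBr mulmxBl.
  transitivity (h^-1 * (mxcoef (T := R) idfun F (D j) (h *: delta_mx 0 i + x) -
      mxcoef (T := R) idfun F (D j) x)); first by rewrite !mxE.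
  rewrite /mxcoef affval_line !map_mx_idfun [RHS]mxE.
  by rewrite [X in _ = _ * X]mxE [X in _ = _ * (_ + X)]mxE.
apply: cvg_mulmx_entry => k l.
under eq_fun do rewrite /Q mxE [in X in _ * X]mxE [in X in _ + X]mxE.
exact: mxfun_derivative.
Qed.

(** The order of the quantifiers matters: [D'] is chosen before [F], hence is common to exp and all
    its partial sums. *)
Lemma mpartial_mxcoefs (alpha : 'I_p -> nat) (D : 'I_q -> affdata p) :
  exists D', forall F, regular_mxfun F ->
    mpartial alpha (mxcoefs F D) = mxcoefs F D'.
Proof.
rewrite /mpartial; elim: (enum 'I_p) => [|i s [D' IH]]; first by exists D.
exists (fun j => iter (alpha i) (affderiv i) (D' j)) => F Freg /=.
rewrite IH//; elim: (alpha i) => [//|k IHk].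
by rewrite iterS IHk partial_mxcoefs.
Qed.

(** Because [D'] is common, convergence of derivatives is convergence of the exponential series at
    one fixed larger matrix; no uniform convergence in x is involved. *)
Lemma cvg_mpartial_mxcoefs (alpha : 'I_p -> nat) (D : 'I_q -> affdata p) x j :
  (mpartial alpha (mxcoefs (fun n => @mxexp_sum R R idfun K n) D) x 0 j
     @[K --> \oo] --> mpartial alpha (mxcoefs (@mxexp R) D) x 0 j)%classic.
Proof.
have [D' DE] := mpartial_mxcoefs alpha D.
rewrite DE; last exact: regular_mxexp.
under eq_fun do rewrite (DE _ (regular_mxexp_sum _)) mxE.
by rewrite mxE; apply: cvg_mulmx_entry => k l; exact: cvg_mxexp_sum.
Qed.

End IteratedDerivatives.

(** * Prolongation of polynomial maps *)

Definition mpeval {R : Type} {T : comNzRingType} (iota : R -> T) {p}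
    (s : seq (R * ('I_p -> nat))) (x : 'rV[T]_p) : T :=
  \sum_(m <- s) iota m.1 * \prod_i x 0 i ^+ m.2 i.

Section PolynomialMaps.
Context {R : realType} {p q : nat}.
Local Notation term := (R * ('I_p -> nat))%type.

Definition mpmap (s : 'I_q -> seq term) (x : 'rV[R]_p) : 'rV[R]_q :=
  \row_j mpeval (T := R) idfun (s j) x.

(** At exponent 0 the truncated predecessor is harmless, since the new coefficient is 0. *)
Definition mono_deriv (i : 'I_p) (m : term) : term :=
  (m.1 * (m.2 i)%:R, fun k => if k == i then (m.2 i).-1 else m.2 k).

Lemma expr_difference_quotient (x : R) n :
  (h^-1 * ((h + x) ^+ n - x ^+ n) @[h --> (0 : R)^'] -->
    n%:R * x ^+ n.-1)%classic.
Proof.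
have D : is_derive x 1 ((id : R -> R) ^+ n) ((n%:R * x ^+ n.-1) *: 1).
  exact: is_deriveX.
have <- : 'D_1 ((id : R -> R) ^+ n) x = n%:R * x ^+ n.-1.
  by rewrite derive_val /GRing.scale /= mulr1.
have := @ex_derive _ _ _ _ _ _ _ D; rewrite /derivable /derive.
have -> // : (fun h : R => h^-1 *: (((id : R -> R) ^+ n \o shift x) (h *: 1) -
    ((id : R -> R) ^+ n) x)) = (fun h => h^-1 * ((h + x) ^+ n - x ^+ n)).
by apply/funext => h /=; rewrite !exprfctE /GRing.scale /= mulr1.
Qed.

Lemma partial_mpmap i s :
  partial i (mpmap s) = mpmap (fun j => map (mono_deriv i) (s j)).
Proof.
apply/funext => x; apply: cvg_lim; first exact: norm_hausdorff.
apply: cvg_mx_entries => k j; rewrite {k}ord1 mxE /mpeval big_map.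
(* The part of the monomial that is constant in the i-th variable. *)
pose C (m : term) := m.1 * \prod_(k | k != i) x 0 k ^+ m.2 k.
have -> : (fun h : R => (h^-1 *: ((mpmap s \o shift x) (h *: delta_mx 0 i) -
      mpmap s x)) 0 j) =
    (fun h => \sum_(m <- s j)
      C m * (h^-1 * ((h + x 0 i) ^+ m.2 i - x 0 i ^+ m.2 i))).
  apply/funext => h; rewrite !mxE /mpeval -sumrB mulr_sumr.
  apply: eq_bigr => m _; rewrite -mulrBr [RHS]mulrCA; congr (_ * _).
  rewrite /C -mulrA; congr (_ * _).
  rewrite (bigD1 i)//= [X in _ - X](bigD1 i)//= !mxE !eqxx mulr1.
  rewrite (eq_bigr (fun k => x 0 k ^+ m.2 k)); last first.
    by move=> k ki; rewrite !mxE (negPf ki) andbF mulr0 add0r.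
  by rewrite -mulrBl mulrC.
apply: cvg_big => [y|m _]; first exact: add_continuous.
have -> : idfun (mono_deriv i m).1 * \prod_k x 0 k ^+ (mono_deriv i m).2 k =
    C m * ((m.2 i)%:R * x 0 i ^+ (m.2 i).-1).
  rewrite (bigD1 i)//= eqxx (eq_bigr (fun k => x 0 k ^+ m.2 k)); last first.
    by move=> k ki; rewrite (negPf ki).
  by rewrite /C -!mulrA; congr (_ * _); rewrite [RHS]mulrC -mulrA.
by apply: cvgM; [exact: cvg_cst | exact: expr_difference_quotient].
Qed.

(** The falling factorial is 0 once a exceeds the exponent, so the truncated subtraction does no
    harm. *)
Lemma iter_mono_deriv i a (m : term) :
  iter a (mono_deriv i) m =
  (m.1 * (m.2 i ^_ a)%:R, fun k => if k == i then (m.2 i - a)%N else m.2 k).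
Proof.
elim: a => [|a IH].
  rewrite ffactn0 mulr1 subn0 [LHS]surjective_pairing; congr pair.
  by apply/funext => k; case: eqP => [->|].
rewrite iterS IH /mono_deriv /= eqxx -mulrA -natrM -ffactnSr subnS; congr pair.
by apply/funext => k; case: eqP.
Qed.

Lemma mpartial_mpmap (alpha : 'I_p -> nat) s :
  mpartial alpha (mpmap s) = mpmap (fun j => [seq
    (m.1 * (\prod_i m.2 i ^_ alpha i)%:R, fun k => (m.2 k - alpha k)%N)
    | m <- s j]).
Proof.
rewrite /mpartial.
(* Induction over the variables already differentiated. Without repetitions, the exponent of each
   new variable is still the original one. *)
have E l : uniq l -> foldr (fun i => iter (alpha i) (partial i)) (mpmap s) l =
    mpmap (fun j => [seq (m.1 * (\prod_(i <- l) m.2 i ^_ alpha i)%:R,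
      fun k => if k \in l then (m.2 k - alpha k)%N else m.2 k) | m <- s j]).
  elim: l => [_|i l IH /= /andP[il ul]] /=.
    congr mpmap; apply/funext => j; rewrite -[LHS]map_id; apply: eq_map => m.
    by rewrite big_nil mulr1 -surjective_pairing.
  rewrite IH//.
  have iterE a t : iter a (partial i) (mpmap t) =
      mpmap (fun j => map (iter a (mono_deriv i)) (t j)).
    elim: a => [|a IHa]; first by congr mpmap; apply/funext => j; rewrite map_id.
    rewrite iterS IHa partial_mpmap; congr mpmap; apply/funext => j.
    by rewrite -map_comp.
  rewrite iterE; congr mpmap; apply/funext => j; rewrite -map_comp.
  apply: eq_map => m /=; rewrite iter_mono_deriv /= (negPf il) big_cons.
  rewrite mulnC natrM mulrA; congr pair; apply/funext => k.
  by rewrite in_cons; case: eqP => [->|].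
rewrite E ?enum_uniq//; congr mpmap; apply/funext => j; apply: eq_map => m.
by rewrite big_enum; congr pair; apply/funext => k; rewrite mem_enum.
Qed.

End PolynomialMaps.

Section ProlongedPolynomials.
Context {R : realType} {A : weilAlgType R}.
Local Notation m := (@weil_ideal R A).
Local Notation N := (@weil_index R A).

Lemma nilpotent_part_ideal k l (X : 'M[A]_(k, l)) i j : nilpotent_part X i j \in m.
Proof. by rewrite !mxE; exact: scalar_partP. Qed.

Lemma weil_ideal_exp (x : A) k : x \in m -> x ^+ k \in (m ^+ k)%VS.
Proof.
move=> xm; elim: k => [|k IH]; first by rewrite expv0 expr0 memv_line.
by rewrite exprS expvSl memv_mul.
Qed.

Lemma weil_ideal_prod p (H : 'I_p -> A) (alpha : 'I_p -> nat) :
  (forall i, H i \in m) ->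
  \prod_i H i ^+ alpha i \in (m ^+ (\sum_i alpha i))%VS.
Proof.
move=> Hm; elim/big_rec2: _ => [|i y k _ yk]; first by rewrite expv0 memv_line.
by rewrite expvD memv_mul// weil_ideal_exp.
Qed.

Lemma weil_ideal_nilp k : (N < k)%N -> (m ^+ k)%VS = 0%VS.
Proof. by move=> /subnKC <-; rewrite expvD weil_nilp prod0v. Qed.

Lemma weil_binomial (x : R) (h : A) b : h \in m ->
  \sum_(a < N.+1) ('C(b, a)%:R * x ^+ (b - a)) *: h ^+ a = (x%:A + h) ^+ b.
Proof.
move=> hm.
pose G a := ('C(b, a)%:R * x ^+ (b - a)) *: h ^+ a.
(* Both sums are padded to this common range: terms with a > N vanish since h^a lies in m^a = 0,
   terms with a > b since the binomial coefficient is 0. *)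
pose M := maxn N.+1 b.+1.
transitivity (\sum_(a < M) G a).
  rewrite (big_ord_widen M G) ?leq_maxl// [RHS](bigID (fun a : 'I_M => a < N.+1)%N).
  rewrite /= [X in _ + X]big1 ?addr0// => a; rewrite -leqNgt => Na.
  have := weil_ideal_exp a hm; rewrite weil_ideal_nilp// memv0 => /eqP ha.
  by rewrite /G ha scaler0.
rewrite exprDn (eq_bigr (fun a : 'I_b.+1 => G a)); last first.
  by move=> a _; rewrite /G exprZn expr1n mulr_algl scalerMnl mulr_natl.
rewrite [RHS](big_ord_widen M G) ?leq_maxr//.
rewrite [LHS](bigID (fun a : 'I_M => a < b.+1)%N).
rewrite /= [X in _ + X]big1 ?addr0// => a; rewrite -leqNgt => ba.
by rewrite /G bin_small// mul0r scale0r.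
Qed.

Lemma weil_prolong_mpmap p q (s : 'I_q -> seq (R * ('I_p -> nat))) (X : 'rV[A]_p) :
  weil_prolong (mpmap s) X = \row_j mpeval (in_alg A) (s j) X.
Proof.
apply/rowP => j; rewrite !mxE.
set x := map_mx scalar_part X; set H := nilpotent_part X.
have Hm i : H 0 i \in m by exact: nilpotent_part_ideal.
(* A falling factorial divided by alpha_i! is a binomial coefficient, so the Taylor coefficient of a
   monomial splits into one factor per variable. *)
pose c (b : 'I_p -> nat) (alpha : {ffun 'I_p -> 'I_N.+1}) : R :=
  \prod_i ('C(b i, alpha i)%:R * x 0 i ^+ (b i - alpha i)).
have coefE (alpha : {ffun 'I_p -> 'I_N.+1}) :
    (\prod_i (alpha i)`!)%N%:R^-1 * mpartial (fun i => alpha i) (mpmap s) x 0 j =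
    \sum_(t <- s j) t.1 * c t.2 alpha.
  rewrite mpartial_mpmap mxE /mpeval big_map mulr_sumr.
  apply: eq_bigr => t _; rewrite /= -mulrA mulrCA; congr (_ * _).
  rewrite !natr_prod -prodfV -!big_split; apply: eq_bigr => i _ /=.
  by rewrite -bin_ffact natrM -[X in _ * X]mulrA mulrCA mulKf//
    pnatr_eq0 -lt0n fact_gt0.
under eq_bigr do rewrite coefE scaler_suml.
rewrite exchange_big /=; apply: eq_bigr => t _.
under eq_bigr do rewrite -scalerA.
rewrite -scaler_sumr mulr_algl; congr (_ *: _).
transitivity (\sum_(alpha : {ffun 'I_p -> 'I_N.+1})
    c t.2 alpha *: \prod_i H 0 i ^+ alpha i).
  rewrite [RHS](bigID (fun alpha : {ffun 'I_p -> 'I_N.+1} =>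
    \sum_i alpha i <= N)%N) /=.
  rewrite [X in _ + X]big1 ?addr0// => alpha; rewrite -ltnNge => aN.
  have := weil_ideal_prod (fun i => alpha i) Hm.
  by rewrite weil_ideal_nilp// memv0 => /eqP ->; rewrite scaler0.
under [LHS]eq_bigr do rewrite /c -scaler_prod.
rewrite -(bigA_distr_bigA (fun i (a : 'I_N.+1) =>
  ('C(t.2 i, a)%:R * x 0 i ^+ (t.2 i - a)) *: H 0 i ^+ a)).
apply: eq_bigr => i _; rewrite weil_binomial//.
by rewrite /H /x /nilpotent_part !mxE /= addrCA subrr addr0.
Qed.

End ProlongedPolynomials.

(** * Convergence in a Weil algebra *)

Section Polynomiality.
Context {R : realType} {p : nat}.

(* The same real polynomial must represent [g] over every commutative
   R-algebra, so that one list of terms serves both R and the Weil algebra. *)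
Definition polynomial
    (g : forall T : comNzRingType, {rmorphism R -> T} -> 'rV[T]_p -> T) : Prop :=
  exists s, forall (T : comNzRingType) (iota : {rmorphism R -> T}) X,
    g T iota X = mpeval iota s X.

Lemma polynomial_const c : polynomial (fun T iota X => iota c).
Proof.
exists [:: (c, fun _ => 0%N)] => T iota X.
by rewrite /mpeval big_seq1 big1 ?mulr1// => i _; rewrite expr0.
Qed.

Lemma polynomial_var i : polynomial (fun T iota X => X 0 i).
Proof.
exists [:: (1, fun k => nat_of_bool (k == i))] => T iota X.
rewrite /mpeval big_seq1 rmorph1 mul1r (bigD1 i)//= eqxx expr1.
by rewrite big1 ?mulr1// => k /negPf ->; rewrite expr0.
Qed.

Lemma polynomialD f g : polynomial f -> polynomial g ->
  polynomial (fun T iota X => f T iota X + g T iota X).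
Proof.
move=> [s fs] [t gt]; exists (s ++ t) => T iota X.
by rewrite fs gt /mpeval big_cat.
Qed.

Lemma polynomialM f g : polynomial f -> polynomial g ->
  polynomial (fun T iota X => f T iota X * g T iota X).
Proof.
move=> [s fs] [t gt].
exists [seq (m.1 * n.1, fun k => (m.2 k + n.2 k)%N) | m <- s, n <- t] => T iota X.
rewrite fs gt /mpeval big_allpairs_dep mulr_suml; apply: eq_bigr => m _.
rewrite mulr_sumr; apply: eq_bigr => n _ /=.
rewrite rmorphM mulrACA -big_split /=; congr (_ * _).
by apply: eq_bigr => k _; rewrite exprD.
Qed.

Lemma polynomial_sum (I : Type) (r : seq I) f : (forall i, polynomial (f i)) ->
  polynomial (fun T iota X => \sum_(i <- r) f i T iota X).
Proof.
move=> fpoly; elim: r => [|i r [s IH]].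
  by exists [::] => T iota X; rewrite /mpeval !big_nil.
have [s' fs] := polynomialD (fpoly i) (ex_intro _ s IH).
by exists s' => T iota X; rewrite big_cons fs.
Qed.

Definition polynomial_mx {m n}
    (G : forall T : comNzRingType, {rmorphism R -> T} -> 'rV[T]_p -> 'M[T]_(m, n)) :=
  forall i j, polynomial (fun T iota X => G T iota X i j).

Lemma eq_polynomial f g : (forall T iota X, f T iota X = g T iota X) ->
  polynomial f -> polynomial g.
Proof. by move=> fg [s fs]; exists s => T iota X; rewrite -fg. Qed.

Lemma polynomial_mx_const m n (M : 'M[R]_(m, n)) :
  polynomial_mx (fun T iota X => map_mx iota M).
Proof.
move=> i j; apply: eq_polynomial (polynomial_const (M i j)) => T iota X.
by rewrite mxE.
Qed.

Lemma polynomial_mulmx l m n F G :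
  @polynomial_mx l m F -> @polynomial_mx m n G ->
  polynomial_mx (fun T iota X => F T iota X *m G T iota X).
Proof.
move=> Fp Gp i j; pose f k := polynomialM (Fp i k) (Gp k j).
by apply: eq_polynomial (polynomial_sum (index_enum _) f) => T iota X; rewrite mxE.
Qed.

Lemma polynomial_mx_exp n F k : @polynomial_mx n n F ->
  polynomial_mx (fun T iota X => F T iota X ^+ k).
Proof.
move=> Fp; elim: k => [|k IH] i j.
  apply: eq_polynomial (polynomial_mx_const 1%:M i j) => T iota X.
  by rewrite map_mx1.
apply: eq_polynomial (polynomial_mulmx Fp IH i j) => T iota X.
by rewrite mxpowS.
Qed.

Lemma polynomial_affval (D : @affdata R p) :
  polynomial_mx (fun T iota X => affval iota D X).
Proof.
move=> i j.
pose f k := polynomialM (polynomial_var k) (polynomial_mx_const (acoef D k) i j).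
have := polynomialD (polynomial_mx_const (aconst D) i j)
  (polynomial_sum (index_enum _) f).
apply: eq_polynomial => T iota X.
by rewrite [RHS]mxE summxE; congr (_ + _); apply: eq_bigr => k _; rewrite [RHS]mxE.
Qed.

Lemma polynomial_mxcoef K (D : @affdata R p) :
  polynomial (fun T iota X => mxcoef iota (@mxexp_sum R T iota K) D X).
Proof.
have expP : polynomial_mx
    (fun T iota X => mxexp_sum iota K (affval iota D X)).
  move=> i j; pose f (k : 'I_K) := polynomialM (polynomial_const k`!%:R^-1)
    (polynomial_mx_exp k (@polynomial_affval D) i j).
  apply: eq_polynomial (polynomial_sum (index_enum _) f) => T iota X.
  by rewrite summxE; apply: eq_bigr => k _; rewrite [RHS]mxE.
exact: polynomial_mulmx (polynomial_mulmx (polynomial_mx_const _) expP)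
  (polynomial_mx_const _) 0 0.
Qed.

End Polynomiality.

Section CoordinateConvergence.
Context {R : realType} {A : weilAlgType R}.
Local Notation e := (vbasis {:A}).

(** Convergence in the finite-dimensional real space A, read in a fixed basis. *)
Definition cvg_coord (u : nat -> A) (l : A) : Prop :=
  forall i, (coord e i (u K) @[K --> \oo] --> coord e i l)%classic.

Lemma expand_vbasis (x : A) : x = \sum_i coord e i x *: e`_i.
Proof. by apply: coord_vbasis; rewrite memvf. Qed.

Lemma cvg_coord_unique u l l' : cvg_coord u l -> cvg_coord u l' -> l = l'.
Proof.
move=> ul ul'; rewrite (expand_vbasis l) (expand_vbasis l').
apply: eq_bigr => i _; congr (_ *: _).
exact: cvg_unique (ul i) (ul' i).
Qed.

Lemma cvg_coord_cst l : cvg_coord (fun=> l) l.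
Proof. by move=> i; exact: cvg_cst. Qed.

Lemma cvg_coordZ (u : nat -> R) (a : R) x : (u K @[K --> \oo] --> a)%classic ->
  cvg_coord (fun K => u K *: x) (a *: x).
Proof.
move=> ua i; under eq_fun do rewrite linearZ; rewrite linearZ.
by apply: cvgM; [exact: ua | exact: cvg_cst].
Qed.

Lemma cvg_coord_sum (I : Type) (r : seq I) (P : pred I) u l :
  (forall i, P i -> cvg_coord (u i) (l i)) ->
  cvg_coord (fun K => \sum_(i <- r | P i) u i K) (\sum_(i <- r | P i) l i).
Proof.
move=> ul k; under eq_fun do rewrite linear_sum; rewrite linear_sum.
by apply: cvg_big => [y|i Pi]; [exact: add_continuous | exact: ul].
Qed.

Lemma cvg_coordD u v l k : cvg_coord u l -> cvg_coord v k ->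
  cvg_coord (fun K => u K + v K) (l + k).
Proof.
move=> ul vk i; under eq_fun do rewrite linearD; rewrite linearD.
by apply: cvgD; [exact: ul | exact: vk].
Qed.

Lemma cvg_coordM u v l k : cvg_coord u l -> cvg_coord v k ->
  cvg_coord (fun K => u K * v K) (l * k).
Proof.
move=> ul vk.
(* Bilinearity reduces continuity of the product to that of products of real coordinates. *)
have E x y : x * y = \sum_i \sum_j (coord e i x * coord e j y) *: (e`_i * e`_j).
  rewrite {1}(expand_vbasis x) {1}(expand_vbasis y) mulr_suml; apply: eq_bigr => i _.
  rewrite mulr_sumr; apply: eq_bigr => j _.
  by rewrite -scalerAl -scalerAr scalerA.
rewrite E (_ : (fun K => _) = fun K => \sum_i \sum_j
  (coord e i (u K) * coord e j (v K)) *: (e`_i * e`_j)); last first.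
  by apply/funext => K; rewrite E.
apply: cvg_coord_sum => i _; apply: cvg_coord_sum => j _.
by apply: cvg_coordZ; apply: cvgM; [exact: ul | exact: vk].
Qed.

(** Each partial sum is polynomial, so its value in A is its prolongation. A prolongation is a
    finite sum whose real coefficients are derivatives at the scalar part, and these converge. *)
Lemma cvg_coord_weil_prolong {p q} (D : 'I_q -> @affdata R p) (X : 'rV[A]_p) j :
  cvg_coord (fun K => mxcoef (in_alg A) (@mxexp_sum R A (in_alg A) K) (D j) X)
    (weil_prolong (mxcoefs (@mxexp R) D) X 0 j).
Proof.
have -> : (fun K => mxcoef (in_alg A) (@mxexp_sum R A (in_alg A) K) (D j) X) =
    (fun K => weil_prolong (mxcoefs (fun n => @mxexp_sum R R idfun K n) D) X 0 j).
  apply/funext => K.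
  have [s sE] := fin_all_exists (fun j => polynomial_mxcoef K (D j)).
  have -> : mxcoefs (fun n => @mxexp_sum R R idfun K n) D = mpmap s.
    by apply/funext => x; apply/rowP => k; rewrite !mxE -sE.
  by rewrite weil_prolong_mpmap mxE -sE.
rewrite mxE; under eq_fun do rewrite mxE.
apply: cvg_coord_sum => alpha _; apply: cvg_coordZ.
apply: cvgM; first exact: cvg_cst.
exact: cvg_mpartial_mxcoefs.
Qed.

End CoordinateConvergence.

(** * Entries of exponentials *)

Section MatrixExponentialProlongation.
Context {R : realType} {A : weilAlgType R}.

(** The affine map is [vec_mx] itself, and unit vectors on both sides pick the entry. *)
Lemma mxcoef_entry n (k : 'I_(n * n)) : exists D : @affdata R (n * n),
  forall (T : comNzRingType) (iota : {rmorphism R -> T})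
    (F : forall m, 'M[T]_m -> 'M[T]_m) X,
  mxcoef iota F D X = mxvec (F n (vec_mx X)) 0 k.
Proof.
case/mxvec_indexP: k => i j.
exists (AffData 0 (fun l => vec_mx (delta_mx 0 l)) (delta_mx 0 i) (delta_mx j 0)).
move=> T iota F X; rewrite /mxcoef /affval /= mxvecE map_mx0 add0r.
under eq_bigr do rewrite map_vec_mx map_delta_mx -linearZ.
rewrite -linear_sum -row_sum_delta !map_delta_mx -rowE -colE.
by rewrite !mxE.
Qed.

Lemma cvg_coord_weil_exp n (X : 'M[A]_n.+1) i j :
  cvg_coord (fun K => mxexp_sum (in_alg A) K X i j) (weil_prolong_mx expmx X i j).
Proof.
have [D DE] := fin_all_exists (@mxcoef_entry n.+1).
have expE : (fun v => mxvec (expmx (vec_mx v))) = mxcoefs (@mxexp R) D.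
  apply/funext => v; apply/rowP => k.
  by rewrite expmxE mxE (DE k R idfun (@mxexp R)).
have := @cvg_coord_weil_prolong R A _ _ D (mxvec X) (mxvec_index i j).
rewrite -expE [weil_prolong_mx _ _ _ _]mxE.
under eq_fun do rewrite DE mxvecK mxvecE.
by [].
Qed.

End MatrixExponentialProlongation.

(* y^(3) = - s y^(1) as a first order system: the entries 1 and 2 of the first row
   of its propagator at time 1 are a(s) and b(s). *)
Definition companion {T : comNzRingType} (s : T) : 'M[T]_3 :=
  delta_mx 0 1 + delta_mx 1 2 + s *: - delta_mx 2 1.

Section Companion.
Context {T : comNzRingType} (s : T).

Lemma mulmx_companion (X : 'M[T]_3) i :
  ((X *m companion s) i 0 = 0) * ((X *m companion s) i 1 = X i 0 - s * X i 2) *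
  ((X *m companion s) i 2 = X i 1).
Proof.
have e1 : lift ord0 ord0 = 1 :> 'I_3 by exact: val_inj.
have e2 : lift ord0 (lift ord0 ord0) = 2 :> 'I_3 by exact: val_inj.
by do !split; rewrite mxE !big_ord_recl big_ord0 ?e1 ?e2 !mxE /= ;
  rewrite ?(mulr0, mulr1, addr0, add0r, oppr0, mulrN1, mulrN) // mulrC.
Qed.

Definition companion0 k := (companion s ^+ k) 0 0.
Definition companion1 k := (companion s ^+ k) 0 1.
Definition companion2 k := (companion s ^+ k) 0 2.

Lemma companion_pow0 :
  (companion0 0 = 1) * (companion1 0 = 0) * (companion2 0 = 0).
Proof. by rewrite /companion0 /companion1 /companion2 !mxE. Qed.

Lemma companion_powS k : (companion0 k.+1 = 0) *
  (companion1 k.+1 = companion0 k - s * companion2 k) *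
  (companion2 k.+1 = companion1 k).
Proof.
by rewrite /companion0 /companion1 /companion2 mxpowSr !mulmx_companion.
Qed.

Lemma companion1_rec k : companion1 k.+2 = - s * companion1 k.
Proof. by rewrite !companion_powS sub0r mulNr. Qed.

End Companion.

Section RealCompanion.
Context {R : realType}.
Implicit Types r s : R.

(** The right-hand side is k! times the k-th term of the sine series at r; the factor r avoids
    dividing by it. *)
Lemma companion1_sin r k :
  r * companion1 (r ^+ 2) k = (odd k)%:R * (-1) ^+ k.-1./2 * r ^+ k.
Proof.
(* Two consecutive indices are carried, as [companion1_rec] is a recurrence with step two. *)
suff: r * companion1 (r ^+ 2) k = (odd k)%:R * (-1) ^+ k.-1./2 * r ^+ k /\
  r * companion1 (r ^+ 2) k.+1 = (~~ odd k)%:R * (-1) ^+ k./2 * r ^+ k.+1 by case.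
elim: k => [|k [IH1 IH2]].
  by rewrite !companion_powS !companion_pow0 /= !(mulr0, subr0, mul0r, mul1r, mulr1).
split; first by rewrite IH2.
rewrite companion1_rec mulrCA IH1 /= negbK.
case: k {IH1 IH2} => [|k] /=; first by rewrite !mul0r mulr0.
case: (odd k); rewrite /= ?mul0r ?mulr0//.
by rewrite !mul1r !exprS; ring.
Qed.

Lemma companion1_sinh r k :
  r * companion1 (- r ^+ 2) k = (r ^+ k - (- r) ^+ k) / 2.
Proof.
suff: r * companion1 (- r ^+ 2) k = (r ^+ k - (- r) ^+ k) / 2 /\
  r * companion1 (- r ^+ 2) k.+1 = (r ^+ k.+1 - (- r) ^+ k.+1) / 2 by case.
elim: k => [|k [IH1 IH2]].
  by rewrite !companion_powS !companion_pow0 !expr1; split; field.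
by split=> //; rewrite companion1_rec mulrCA IH1 !exprS; field.
Qed.

(** Since [companion2] at k + 1 is [companion1] at k, this is the sine case shifted by one; the
    summand at k = 0 is the 1 of 1 - cos. *)
Lemma companion2_cos r k :
  r ^+ 2 * companion2 (r ^+ 2) k =
  (k == 0%N)%:R - (~~ odd k)%:R * (-1) ^+ k./2 * r ^+ k.
Proof.
case: k => [|k]; first by rewrite companion_pow0 /= mulr0 !mulr1 subrr.
rewrite companion_powS expr2 -mulrA companion1_sin sub0r /= negbK.
case: k => [|k] /=; first by rewrite !mul0r mulr0 oppr0.
by case: (odd k); rewrite /= ?mul0r ?mulr0 ?oppr0// !mul1r !exprS; ring.
Qed.

Lemma companion2_cosh r k :
  r ^+ 2 * companion2 (- r ^+ 2) k = (r ^+ k + (- r) ^+ k) / 2 - (k == 0%N)%:R.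
Proof.
case: k => [|k]; first by rewrite companion_pow0 !expr0 /= mulr0; field.
by rewrite companion_powS expr2 -mulrA companion1_sinh subr0 !exprS; field.
Qed.

Lemma companion1_0 k : companion1 (0 : R) k = (k == 1%N)%:R.
Proof.
by case: k => [|[|k]]; rewrite ?companion1_rec ?companion_powS ?companion_pow0
  ?(oppr0, mul0r, subr0).
Qed.

Lemma cvg_series_delta (a : nat) (c : R) :
  (series (fun k => (k == a)%:R * c) K @[K --> \oo] --> c)%classic.
Proof.
apply: cvg_near_cst; near=> K.
have aK : (a < K)%N by near: K; exact: nbhs_infty_gt.
rewrite seriesEord /= (bigD1 (Ordinal aK))//= eqxx mul1r big1 ?addr0// => k ka.
by rewrite (_ : _ == a = false) ?mul0r//; exact: negPf ka.
Unshelve. all: by end_near. Qed.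

Lemma cvg_companion_series s k :
  (series (fun n => n`!%:R^-1 * (companion s ^+ n) 0 k) K @[K --> \oo] -->
    mxexp (companion s) 0 k)%classic.
Proof.
rewrite (_ : series _ = fun K => mxexp_sum idfun K (companion s) 0 k).
  exact: cvg_mxexp_sum.
by apply/funext => K; rewrite mxexp_sumE.
Qed.

(** In the applications c is the denominator of a(s) or b(s), cleared before series are compared
    term by term; at s = 0 it is 1. *)
Lemma cvg_series_unique (u v : nat -> R) (c m l : R) : (forall k, c * u k = v k) ->
  (series u K @[K --> \oo] --> m)%classic ->
  (series v K @[K --> \oo] --> l)%classic -> c * m = l.
Proof.
move=> uv um vl.
have cm : (c * series u K @[K --> \oo] --> c * m)%classic.
  by apply: cvgM um; exact: cvg_cst.
have E : (fun K => c * series u K) = series v.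
  apply/funext => K; rewrite !seriesEord mulr_sumr; apply: eq_bigr => k _.
  exact: uv.
by rewrite E in cm; exact: cvg_unique cm vl.
Qed.

Lemma cvg_expR_series r : (series (exp_coeff r) K @[K --> \oo] --> expR r)%classic.
Proof. exact: is_cvg_series_exp_coeff. Qed.

Lemma cvg_sin_series r : (series (sin_coeff r) K @[K --> \oo] --> sin r)%classic.
Proof. by rewrite sin.unlock; exact: is_cvg_series_sin_coeff. Qed.

Lemma cvg_cos_series r : (series (cos_coeff r) K @[K --> \oo] --> cos r)%classic.
Proof. by rewrite cos.unlock; exact: is_cvg_series_cos_coeff. Qed.

Lemma series_lincomb (u v : nat -> R) c d :
  series (fun k => c * u k + d * v k) = fun K => c * series u K + d * series v K.
Proof.
by apply/funext => K; rewrite !seriesEord /= !mulr_sumr -big_split.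
Qed.

Lemma cvg_series_lincomb (u v : nat -> R) (c d l m : R) :
  (series u K @[K --> \oo] --> l)%classic ->
  (series v K @[K --> \oo] --> m)%classic ->
  (series (fun k => c * u k + d * v k) K @[K --> \oo] --> c * l + d * m)%classic.
Proof.
move=> ul vm; rewrite series_lincomb.
by apply: cvgD; apply: cvgM => //; exact: cvg_cst.
Qed.

Lemma afun_companion s : afun s = mxexp (companion s) 0 1.
Proof.
have cvgs := @cvg_companion_series s 1.
rewrite /afun; case: ltrgtP => [s0|s0|s0].
- have r0 : Num.sqrt s != 0 by rewrite sqrtr_eq0 -ltNge.
  apply: (mulfI r0); rewrite mulrCA divff// mulr1; apply: esym.
  apply: (cvg_series_unique _ cvgs (@cvg_sin_series _)) => k.
  rewrite mulrCA /sin_coeff /= -companion1_sin sqr_sqrtr ?ltW//.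
  by rewrite mulrC.
- have s0' : 0 < - s by rewrite oppr_gt0.
  have r0 : Num.sqrt (- s) != 0 by rewrite sqrtr_eq0 -ltNge.
  apply: (mulfI r0); rewrite mulrCA divff// mulr1; apply: esym.
  rewrite (_ : sinh _ = 2^-1 * expR (Num.sqrt (- s)) +
    (- 2^-1) * expR (- Num.sqrt (- s))); last by rewrite /sinh; field.
  apply: (cvg_series_unique _ cvgs (cvg_series_lincomb (@cvg_expR_series _)
    (@cvg_expR_series _))) => k.
  rewrite mulrCA -[s in companion s]opprK -{2}(sqr_sqrtr (ltW s0')).
  by rewrite -/(companion1 _ _) companion1_sinh /exp_coeff /=; ring.
- rewrite -s0 in cvgs *; rewrite -[RHS]mul1r; apply: esym.
  apply: (cvg_series_unique _ cvgs (@cvg_series_delta 1 1)) => k.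
  rewrite mul1r -/(companion1 0 k) companion1_0.
  by case: eqP => [->|]; rewrite ?mulr0 ?mul0r// !mulr1 invr1.
Qed.

Lemma bfun_companion s : bfun s = mxexp (companion s) 0 2.
Proof.
have cvgs := @cvg_companion_series s 2.
rewrite /bfun; case: ltrgtP => [s0|s0|s0].
- have r0 : s != 0 by rewrite gt_eqF.
  apply: (mulfI r0); rewrite mulrCA divff// mulr1; apply: esym.
  rewrite -[1 in RHS]mul1r -[cos _]mul1r -mulNr.
  apply: (cvg_series_unique _ cvgs (cvg_series_lincomb (@cvg_series_delta 0 1)
    (@cvg_cos_series _))) => k.
  rewrite mulrCA -{1 2}(sqr_sqrtr (ltW s0)) -/(companion2 _ _) companion2_cos.
  rewrite /cos_coeff /= -exprnP.
  by case: k => [|k]; rewrite /= ?fact0; [field | ring].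
- have s0' : 0 < - s by rewrite oppr_gt0.
  have r0 : - s != 0 by rewrite gt_eqF.
  apply: (mulfI r0); rewrite mulrCA divff// mulr1; apply: esym.
  rewrite /cosh.
  rewrite (_ : _ - 1 = 1 * (2^-1 * expR (Num.sqrt (- s)) +
    2^-1 * expR (- Num.sqrt (- s))) + (-1) * 1); last by field.
  apply: (cvg_series_unique _ cvgs (cvg_series_lincomb (cvg_series_lincomb
    (@cvg_expR_series _) (@cvg_expR_series _)) (@cvg_series_delta 0 1))) => k.
  rewrite mulrCA -[s in companion s]opprK -{1 2}(sqr_sqrtr (ltW s0')).
  rewrite -/(companion2 _ _) companion2_cosh /exp_coeff /=.
  by case: k => [|k]; rewrite /= ?fact0; [field | ring].
- rewrite -s0 in cvgs *; rewrite -[RHS]mul1r; apply: esym.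
  (* At s = 0 only the term k = 2 survives, with coefficient 1 / 2!. *)
  apply: (cvg_series_unique _ cvgs (@cvg_series_delta 2 (1 / 2))) => k.
  rewrite mul1r -/(companion2 0 k).
  case: k => [|k]; first by rewrite companion_pow0 mulr0 mul0r.
  rewrite companion_powS companion1_0 eqSS.
  by case: eqP => [->|]; rewrite ?mulr0 ?mul0r// mul1r mulr1 div1r.
Qed.

End RealCompanion.

(** * The product of opposite exponentials *)

Section ExponentialOfOpposite.
Context {R : realType}.

(** The degree n part of the Cauchy product of e^x and e^y: it vanishes for x = -1, y = 1 and n > 0,
    and yields the series of e^(2C) for x = y = C. *)
Lemma exp_coeff_binomial (x y : R) n :
  \sum_(a < n.+1) exp_coeff x a * exp_coeff y (n - a)%N = exp_coeff (x + y) n.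
Proof.
rewrite /exp_coeff /= addrC exprDn mulr_suml; apply: eq_bigr => a _.
have an : (a <= n)%N by rewrite -ltnS.
rewrite -[X in _ = X / _]mulr_natr -(bin_fact an) !natrM.
have [f g h] : [/\ a`!%:R != 0 :> R, (n - a)`!%:R != 0 :> R &
    'C(n, a)%:R != 0 :> R].
  by rewrite !pnatr_eq0 -!lt0n !fact_gt0 bin_gt0.
by field; rewrite ?f ?g ?h.
Qed.

Lemma sum_triangle (V : zmodType) (G : nat -> nat -> V) K :
  \sum_(a < K) \sum_(b < K - a) G a b =
  \sum_(n < K) \sum_(a < n.+1) G a (n - a)%N.
Proof.
elim: K => [|K IH]; first by rewrite !big_ord0.
rewrite [RHS]big_ord_recr /= -IH [X in _ = X + _](_ : _ =
    \sum_(a < K.+1) \sum_(b < K - a) G a b); last first.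
  by rewrite [RHS]big_ord_recr /= subnn big_ord0 addr0.
rewrite -big_split; apply: eq_bigr => a _ /=.
by rewrite subSn -1?ltnS// big_ord_recr.
Qed.

Lemma sum_square_triangle (V : zmodType) (G : nat -> nat -> V) K :
  \sum_(a < K) \sum_(b < K) G a b =
  \sum_(a < K) \sum_(b < K - a) G a b +
  \sum_(a < K) \sum_(K - a <= b < K) G a b.
Proof.
rewrite -big_split; apply: eq_bigr => a _ /=.
by rewrite -!(big_mkord xpredT) -big_cat_nat ?leq_subr.
Qed.

(* The diagonals a + b = n < K cancel except n = 0, and the remaining part of
   the square is dominated by the same part for e^C e^C = e^(2C). *)
Lemma cvg_exp_opp_product (m : nat -> R) M C : 0 <= C ->
  (forall k, `|m k| <= M * C ^+ k) ->
  (\sum_(a < K) \sum_(b < K) exp_coeff (-1) a * exp_coeff 1 b * m (a + b)%N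
    @[K --> \oo] --> m 0%N)%classic.
Proof.
move=> C0 mC.
pose G a b := exp_coeff (-1) a * exp_coeff 1 b * m (a + b)%N.
pose H a b := M * (exp_coeff C a * exp_coeff C b).
have GH a b : `|G a b| <= H a b.
  have -> : H a b = a`!%:R^-1 * b`!%:R^-1 * (M * C ^+ (a + b)).
    by rewrite /H /exp_coeff /= exprD; ring.
  rewrite /G normrM (_ : `|_ * _| = a`!%:R^-1 * b`!%:R^-1) ?ler_wpM2l ?mulr_ge0//.
  rewrite /exp_coeff /= !normrM normrX normrN1 normrX normr1 !expr1n !mul1r.
  by rewrite !normfV !normr_nat.
have triG K : (0 < K)%N -> \sum_(a < K) \sum_(b < K - a) G a b = m 0%N.
  case: K => // K _; rewrite sum_triangle big_ord_recl [X in _ + X]big1 => [|n _].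
    by rewrite addr0 /= big_ord1 /G /exp_coeff /= !expr0 invr1 !mul1r.
  rewrite /= (eq_bigr (fun a : 'I_n.+2 =>
    exp_coeff (-1) a * exp_coeff 1 (n.+1 - a)%N * m n.+1)); last first.
    by move=> a _; rewrite /G subnKC// -ltnS.
  by rewrite -mulr_suml exp_coeff_binomial addNr /exp_coeff /= expr0n mul0r mul0r.
have triH K : \sum_(a < K) \sum_(b < K - a) H a b =
    M * series (exp_coeff (C + C)) K.
  rewrite sum_triangle seriesEord /= mulr_sumr; apply: eq_bigr => n _.
  by rewrite /H -mulr_sumr exp_coeff_binomial.
have sqH K : \sum_(a < K) \sum_(b < K) H a b =
    M * (series (exp_coeff C) K * series (exp_coeff C) K).
  rewrite seriesEord /= mulr_suml mulr_sumr; apply: eq_bigr => a _.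
  by rewrite /H -!mulr_sumr.
pose d K := M * (series (exp_coeff C) K * series (exp_coeff C) K) -
  M * series (exp_coeff (C + C)) K.
have d0 : (d K @[K --> \oo] --> (0 : R))%classic.
  have := cvg_expR_series (R := R).
  rewrite -(subrr (M * expR (C + C))) {1}expRD => ecvg.
  apply: cvgB; apply: cvgM; [exact: cvg_cst| |exact: cvg_cst|exact: ecvg].
  by apply: cvgM; exact: ecvg.
apply/cvgrPdist_le => e e0; near=> K.
rewrite (sum_square_triangle G) triG; last by near: K; exact: nbhs_infty_gt.
rewrite opprD addrA subrr add0r normrN.
have dE : d K = \sum_(a < K) \sum_(K - a <= b < K) H a b.
  by rewrite /d -sqH -triH sum_square_triangle addrC addKr.
apply: (le_trans (y := d K)).
  rewrite dE (le_trans (ler_norm_sum _ _ _))//; apply: ler_sum => a _.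
  by rewrite (le_trans (ler_norm_sum _ _ _))//; apply: ler_sum.
rewrite (le_trans (ler_norm _))//.
near: K; have /cvgrPdist_le/(_ e e0) := d0.
by apply: filterS => K; rewrite sub0r normrN.
Unshelve. all: by end_near. Qed.

(** * Coordinate norm and growth of matrix powers over A *)

Context {A : weilAlgType R}.
Local Notation e := (vbasis {:A}).

Definition coord_norm (x : A) : R := \sum_i `|coord e i x|.

Lemma coord_norm_sum (I : Type) (r : seq I) (F : I -> A) :
  coord_norm (\sum_(i <- r) F i) <= \sum_(i <- r) coord_norm (F i).
Proof.
rewrite /coord_norm exchange_big /=; apply: ler_sum => i _.
by rewrite linear_sum ler_norm_sum.
Qed.

Lemma coord_norm_ge0 x : 0 <= coord_norm x.
Proof. by apply: sumr_ge0 => i _. Qed.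

Lemma coord_normZ a x : coord_norm (a *: x) = `|a| * coord_norm x.
Proof.
rewrite /coord_norm mulr_sumr; apply: eq_bigr => i _.
by rewrite linearZ normrM.
Qed.

Lemma coord_le_norm i x : `|coord e i x| <= coord_norm x.
Proof. by rewrite /coord_norm (bigD1 i)//= lerDl sumr_ge0. Qed.

(** The l^1 norm of coordinates need not be submultiplicative; the sum over the basis bounds the
    operator norm of multiplication by y instead. *)
Lemma coord_normM y x :
  coord_norm (y * x) <= (\sum_(i < \dim {:A}) coord_norm (y * e`_i)) * coord_norm x.
Proof.
rewrite {1}(expand_vbasis x) mulr_sumr (le_trans (coord_norm_sum _ _))//.
rewrite mulr_suml; apply: ler_sum => i _.
rewrite -scalerAr coord_normZ mulrC ler_wpM2l ?coord_norm_ge0//.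
exact: coord_le_norm.
Qed.

Lemma mxpow_coord_bounded n (X : 'M[A]_n) : exists C, 0 <= C /\
  forall k i j, coord_norm ((X ^+ k) i j) <= coord_norm 1 * C ^+ k.
Proof.
pose c i l := \sum_(h < \dim {:A}) coord_norm (X i l * e`_h).
have c0 i l : 0 <= c i l by apply: sumr_ge0 => h _; exact: coord_norm_ge0.
(* [D] adds the multiplication bounds of all entries of X, hence dominates every row sum used in the
   induction. *)
pose D := \sum_i \sum_l c i l; exists D; split.
  by apply: sumr_ge0 => i _; apply: sumr_ge0.
elim=> [|k IH] i j.
  rewrite !expr0 mulr1 mxE; case: (i == j) => //.
  by rewrite /coord_norm big1 ?coord_norm_ge0// => l _; rewrite linear0 normr0.
rewrite mxpowS mxE (le_trans (coord_norm_sum _ _))//.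
have S0 h : 0 <= \sum_l c h l by apply: sumr_ge0.
rewrite exprS mulrCA (le_trans (y := (\sum_l c i l) * (coord_norm 1 * D ^+ k)))//.
  rewrite mulr_suml; apply: ler_sum => l _.
  by rewrite (le_trans (coord_normM _ _))// ler_wpM2l ?c0 ?IH.
rewrite ler_wpM2r ?mulr_ge0 ?coord_norm_ge0 ?exprn_ge0//; first exact: sumr_ge0.
by rewrite /D [leRHS](bigD1 i)//= lerDl sumr_ge0.
Qed.

Lemma mxpowN {T : comNzRingType} n (X : 'M[T]_n) k :
  (- X) ^+ k = (-1) ^+ k *: X ^+ k.
Proof.
elim: k => [|k IH]; first by rewrite !expr0 scale1r.
by rewrite !mxpowS IH mulNmx -scalemxAr exprS mulN1r scaleNr.
Qed.

(** Coordinatewise this is [cvg_exp_opp_product] for m k the coordinate of the entry of X^k: the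
    signs of (-X)^a are absorbed in [exp_coeff (-1) a]. *)
Lemma cvg_coord_exp_opp n (X : 'M[A]_n) i j :
  cvg_coord (fun K => (mxexp_sum (in_alg A) K (- X) *m mxexp_sum (in_alg A) K X) i j)
    (1%:M i j).
Proof.
move=> l; have [C [C0 XC]] := mxpow_coord_bounded X.
pose m k := coord e l ((X ^+ k) i j).
have mC k : `|m k| <= coord_norm 1 * C ^+ k.
  by rewrite (le_trans (coord_le_norm _ _)).
have := cvg_exp_opp_product C0 mC.
rewrite {2}/m expr0; apply: cvg_trans.
rewrite (_ : (fun K => coord _ _ _) = (fun K =>
  \sum_(a < K) \sum_(b < K) exp_coeff (-1) a * exp_coeff 1 b * m (a + b)%N)) //.
apply/funext => K.
rewrite mulmx_suml summxE linear_sum; apply: eq_bigr => a _ /=.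
rewrite mulmx_sumr summxE linear_sum; apply: eq_bigr => b _ /=.
rewrite mxpowN -!scalemxAl -scalemxAr -[X ^+ a *m _]exprD !scalerA mxE.
rewrite -(rmorph_sign (in_alg A)) -!(rmorphM (in_alg A)) mulr_algl linearZ.
by rewrite /exp_coeff /= expr1n; congr (_ * _); ring.
Qed.

End ExponentialOfOpposite.

(** * Rodrigues formula *)

Section Rodrigues.
Context {R : realType} {A : weilAlgType R}.

(** The companion matrix is affine in s, so f is an entry of exp along an affine map in one variable
    and [cvg_coord_weil_prolong] applies. *)
Lemma cvg_coord_companion (f : R -> R) k :
  (forall s, f s = mxexp (companion s) 0 k) -> forall S : A,
  cvg_coord (fun K => mxexp_sum (in_alg A) K (companion S) 0 k)
    (weil_prolong1 f S).
Proof.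
move=> fE S.
pose D : @affdata R 1 := AffData (delta_mx 0 1 + delta_mx 1 2)
  (fun=> - delta_mx 2 1) (delta_mx 0 0) (delta_mx k 0).
have DE (T : comNzRingType) (iota : {rmorphism R -> T})
    (F : forall m, 'M[T]_m -> 'M[T]_m) X :
    mxcoef iota F D X = F 3 (companion (X 0 0)) 0 k.
  rewrite /mxcoef /affval big_ord1 /= map_mxD map_mxN !map_delta_mx.
  by rewrite -rowE -colE !mxE.
have -> : weil_prolong1 f S =
    weil_prolong (mxcoefs (@mxexp R) (fun _ : 'I_1 => D)) (const_mx S) 0 0.
  rewrite /weil_prolong1; congr (weil_prolong _ _ 0 0).
  apply/funext => v; apply/rowP => i.
  by rewrite !mxE fE (DE R idfun (@mxexp R)).
have := @cvg_coord_weil_prolong R A _ _ (fun _ : 'I_1 => D) (const_mx S) 0.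
rewrite (_ : (fun K => _) =
  fun K => mxexp_sum (in_alg A) K (companion S) 0 k)//.
by apply/funext => K; rewrite DE mxE.
Qed.

(** Right multiplication by B sends the coefficients (c0, c1, c2) on I, B, B^2 to (0, c0 - s c2,
    c1), which is the row times [companion s]; the start (1, 0, 0) makes row 0 of its powers
    appear. *)
Lemma mxpow_rodrigues {T : comNzRingType} n (B : 'M[T]_n) (s : T) k :
  B *m B *m B = - s *: B ->
  B ^+ k = (companion s ^+ k) 0 0 *: 1%:M + (companion s ^+ k) 0 1 *: B +
    (companion s ^+ k) 0 2 *: (B *m B).
Proof.
move=> B3; elim: k => [|k IH].
  by rewrite !expr0 !mxE /= scale1r !scale0r !addr0.
rewrite !mxpowSr IH !mulmx_companion !mulmxDl -!scalemxAl mul1mx B3 scalerA.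
by rewrite scale0r add0r scalerBl mulrN mulrC scaleNr addrAC.
Qed.

Lemma mxexp_sum_rodrigues {T : comNzRingType} (iota : R -> T) K n
    (B : 'M[T]_n) (s : T) : B *m B *m B = - s *: B ->
  mxexp_sum iota K B = mxexp_sum iota K (companion s) 0 0 *: 1%:M +
    mxexp_sum iota K (companion s) 0 1 *: B +
    mxexp_sum iota K (companion s) 0 2 *: (B *m B).
Proof.
move=> B3; rewrite /mxexp_sum !summxE !scaler_suml -!big_split.
apply: eq_bigr => k _ /=; rewrite (mxpow_rodrigues k B3) !scalerDr !scalerA.
by rewrite !mxE.
Qed.

(** Column 0 of every positive power of the companion matrix is zero, so the sums are constant from
    K = 1 on. *)
Lemma cvg_coord_companion00 (S : A) :
  cvg_coord (fun K => mxexp_sum (in_alg A) K (companion S) 0 0) 1.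
Proof.
move=> i; apply: cvg_near_cst; near=> K.
have K0 : (0 < K)%N by near: K; exact: nbhs_infty_gt.
rewrite /mxexp_sum summxE (bigD1 (Ordinal K0))//= !mxE.
rewrite invr1 scale1r mulr1 big1 ?addr0// => k k0.
have {k0} : (0 < k)%N by rewrite lt0n; apply: contra k0 => /eqP k0; exact/eqP/val_inj.
by case: k => [[|k] Kk]//= _; rewrite mxE mxpowSr mulmx_companion mulr0.
Unshelve. all: by end_near. Qed.

(** Both sides are limits of the partial sums at B, the right one through their coefficients on I, B
    and B^2. *)
Lemma weil_exp_rodrigues n (B : 'M[A]_n.+1) S : B *m B *m B = - S *: B ->
  weil_prolong_mx expmx B =
    1%:M + weil_prolong1 afun S *: B + weil_prolong1 bfun S *: (B *m B).
Proof.
move=> B3; apply/matrixP => i j.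
transitivity (1 * (1%:M : 'M[A]_n.+1) i j + weil_prolong1 afun S * B i j +
    weil_prolong1 bfun S * (B *m B) i j); last first.
  rewrite mul1r [RHS]mxE [X in _ = X + _]mxE.
  by congr (_ + _ + _); rewrite [RHS]mxE.
apply: (cvg_coord_unique (@cvg_coord_weil_exp R A n B i j)).
rewrite (_ : (fun K => _) = fun K =>
  mxexp_sum (in_alg A) K (companion S) 0 0 * 1%:M i j +
  mxexp_sum (in_alg A) K (companion S) 0 1 * B i j +
  mxexp_sum (in_alg A) K (companion S) 0 2 * (B *m B) i j); last first.
  apply/funext => K; rewrite (mxexp_sum_rodrigues _ _ B3).
  by rewrite [LHS]mxE [X in X + _ = _]mxE; congr (_ + _ + _); rewrite [LHS]mxE.
apply: cvg_coordD; [apply: cvg_coordD|]; apply: cvg_coordM;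
  try exact: cvg_coord_cst.
- exact: cvg_coord_companion00.
- exact: (cvg_coord_companion (@afun_companion R)).
- exact: (cvg_coord_companion (@bfun_companion R)).
Qed.

Lemma tr_mxexp_sum {T : comNzRingType} (iota : R -> T) K n (X : 'M[T]_n) :
  (mxexp_sum iota K X)^T = mxexp_sum iota K X^T.
Proof.
have powT k : (X ^+ k)^T = X^T ^+ k.
  elim: k => [|k IH]; first by rewrite !expr0 trmx1.
  by rewrite mxpowSr trmx_mul IH mxpowS.
rewrite /mxexp_sum linear_sum; apply: eq_bigr => k _ /=.
by rewrite linearZ /= powT.
Qed.

(** The transpose of a partial sum at B is the partial sum at -B, so [cvg_coord_exp_opp] gives the
    limit of the product. *)
Lemma weil_exp_orthogonal n (B : 'M[A]_n.+1) : B^T = - B ->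
  (weil_prolong_mx expmx B)^T *m weil_prolong_mx expmx B = 1%:M.
Proof.
move=> Bskew; apply/matrixP => i j.
apply: (cvg_coord_unique _ (@cvg_coord_exp_opp R A n.+1 B i j)).
rewrite mxE (_ : (fun K => _) = fun K => \sum_k
  mxexp_sum (in_alg A) K B k i * mxexp_sum (in_alg A) K B k j); last first.
  apply/funext => K; rewrite -Bskew -tr_mxexp_sum mxE.
  by apply: eq_bigr => k _; rewrite mxE.
apply: cvg_coord_sum => k _; rewrite [_^T _ _]mxE.
by apply: cvg_coordM; exact: cvg_coord_weil_exp.
Qed.

End Rodrigues.

Lemma lmod_mulrn2_inj (R : numFieldType) (V : lmodType R) (x y : V) :
  x *+ 2 = y *+ 2 -> x = y.
Proof.
move=> xy; have two0 : 2%:R != 0 :> R by rewrite pnatr_eq0.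
by apply: (scalerI two0); rewrite !scaler_nat.
Qed.

(** * Cube and determinant identities for skew matrices of size 3 *)

Section HatMatrix.
Context {A : comNzRingType}.
Implicit Types phi : 'cV[A]_3.

Lemma sum_ord3 (F : 'I_3 -> A) : \sum_i F i = F 0 + F 1 + F 2.
Proof.
rewrite !big_ord_recl big_ord0 addr0 addrA.
by congr (_ + F _ + F _); exact: val_inj.
Qed.

Lemma forall_ord3 (P : 'I_3 -> Prop) : P 0 -> P 1 -> P 2 -> forall i, P i.
Proof.
move=> P0 P1 P2 [[|[|[|i]]] i3] //.
- by rewrite (_ : Ordinal i3 = 0)//; exact: val_inj.
- by rewrite (_ : Ordinal i3 = 1)//; exact: val_inj.
- by rewrite (_ : Ordinal i3 = 2)//; exact: val_inj.
Qed.

Lemma hat_norm2 phi :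
  (phi^T *m phi) 0 0 = phi 0 0 ^+ 2 + phi 1 0 ^+ 2 + phi 2 0 ^+ 2.
Proof. by rewrite mxE sum_ord3 !mxE !expr2. Qed.

(** This is Cayley-Hamilton for the characteristic polynomial y^3 + S y, checked here entry by
    entry. *)
Lemma hat_cube phi :
  hat phi *m hat phi *m hat phi = - (phi^T *m phi) 0 0 *: hat phi.
Proof.
rewrite hat_norm2; apply/matrixP.
by apply: forall_ord3; apply: forall_ord3; rewrite !(mxE, sum_ord3) /=; ring.
Qed.

Lemma det_mx3 (M : 'M[A]_3) : \det M =
  M 0 0 * (M 1 1 * M 2 2 - M 1 2 * M 2 1) -
  M 0 1 * (M 1 0 * M 2 2 - M 1 2 * M 2 0) +
  M 0 2 * (M 1 0 * M 2 1 - M 1 1 * M 2 0).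
Proof.
(* Indexing by natural numbers lets the lifted ordinals of the cofactor expansion compute to
   numerals. *)
have [m Mm] : exists m : nat -> nat -> A, forall i j, M i j = m i j.
  by exists (fun i j => M (inord i) (inord j)) => i j; rewrite !inord_val.
do 2! rewrite !(expand_det_row _ ord0) !big_ord_recl !big_ord0 /cofactor.
rewrite !det_mx11 !mxE !Mm /= /bump /=; ring.
Qed.

(* With [E = 2b - a^2 - S b^2], the trace of [Q^T Q - I] is [-2 S E] and
   [det Q - 1] is [- S E]. *)
Lemma det_rodrigues phi a b (Q := 1%:M + a *: hat phi + b *: (hat phi *m hat phi)) :
  \det Q *+ 2 = \tr (Q^T *m Q) - 1.
Proof.
rewrite det_mx3 /mxtrace sum_ord3 /Q !(mxE, sum_ord3) /=.
move: (phi 0 0) (phi 1 0) (phi 2 0) => x y z.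
ring.
Qed.

End HatMatrix.

Theorem theorem6p1 (R : realType) (A : weilAlgType R)
    (B : 'M[A]_3) (B_so3 : so3 B)
    (phi : 'cV[A]_3) (B_hat : B = hat phi)
    (S : A) (S_def : S = (phi^T *m phi) 0 0) :
  Exp_weil B =
    1%:M + weil_prolong1 afun S *: B + weil_prolong1 bfun S *: (B *m B)
  /\ SO3 (Exp_weil B).
Proof.
have B3 : B *m B *m B = - S *: B by rewrite B_hat S_def hat_cube.
have ExpB := weil_exp_rodrigues B3.
have orthQ := weil_exp_orthogonal B_so3.
split; first exact: ExpB.
split; first exact: orthQ.
(* With Q^T Q = I, [det_rodrigues] reads 2 det Q = 3 - 1 = 2, and 2 can be cancelled in a real
   vector space. *)
apply: (@lmod_mulrn2_inj R A).
move: orthQ; rewrite /Exp_weil ExpB B_hat => orthQ.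
by rewrite det_rodrigues orthQ mxtrace1 mulrSr addrK.
Qed.
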